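(* There exists a universal constant $C>0$ such that the following holds. Let $\Omega=\mathbb{R}^d$ and let $F_1=\cdots=F_k\subset\mathbb{R}^\Omega$ be $k$ identical function classes, each consisting of all real-valued affine functions: $$F_i=\{x\mapsto w\cdot x+b\ :\ w\in\mathbb{R}^d,\ b\in\mathbb{R}\},\qquad i\in\{1,\ldots,k\}.$$ Let $G_{\max}(F_1,\ldots,F_k)$ be their $k$-fold maximum. Then $$\mathrm{fat}_\gamma(G_{\max}(F_1,\ldots,F_k))\le C\,d\,k\,\mathrm{Log}\,k,\qquad \gamma>0.$$
   Context: $\log$ is the natural logarithm and $\mathrm{Log}(x):=\log(\max\{e,x\})$. The $k$-fold maximum is $$G_{\max}(F_1,\ldots,F_k):=\{x\mapsto \max_{i\in\{1,\ldots,k\}} f_i(x) : f_i\in F_i\}.$$ Fat-shattering dimension: for $F\subset\mathbb{R}^\Omega$ and $\gamma>0$, a finite set $S=\{x_1,\ldots,x_m\}\subset\Omega$ is $\gamma$-shattered by $F$ if $$\sup_{r\in\mathbb{R}^m}\ \min_{y\in\{-1,1\}^m}\ \sup_{f\in F}\ \min_{i\in\{1,\ldots,m\}} y_i(f(x_i)-r_i)\ \ge\ \gamma,$$ and $\mathrm{fat}_\gamma(F)$ is the size of the largest $\gamma$-shattered set (possibly $\infty$). *)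

(* Defs.v *)
From HB Require Import structures.
From mathcomp Require Import all_boot all_order all_algebra.
From mathcomp Require Import all_classical all_reals all_analysis.
Set Implicit Arguments.
Unset Strict Implicit.
Unset Printing Implicit Defensive.
Import Order.TTheory GRing.Theory Num.Theory.
Import numFieldNormedType.Exports.
Local Open Scope classical_set_scope.
Local Open Scope ring_scope.

Definition Log (R : realType) (x : R) : R := ln (Num.max (expR 1) x).

Definition affine_class (R : realType) (d : nat) : set ('rV[R]_d -> R) :=
  [set f | exists (w : 'rV[R]_d) (b : R),
     f = fun x : 'rV[R]_d => \sum_(j < d) w ord0 j * x ord0 j + b].

(* A maximum of reals needs at least one argument, so the number of classes is
   written k.+1; the initial value f ord0 x of the iterated maximum is itself
   one of the arguments. *)
Definition Gmax (R : realType) (T : Type) (k : nat)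
    (F : 'I_k.+1 -> set (T -> R)) : set (T -> R) :=
  [set g | exists f : 'I_k.+1 -> T -> R, (forall i, F i (f i)) /\
     g = fun x => \big[Num.max/f ord0 x]_(i < k.+1) f i x].

(* The suprema may be infinite or not attained, so everything takes values in
   the extended reals. A sign vector in {-1, 1}^m is given by booleans, y i
   standing for (-1) ^+ y i. Minima run over finite types and +oo is their
   value only on an empty range, i.e. for the inner minimum when m = 0. *)
Definition shatter_margin (R : realType) (T : Type) (F : set (T -> R))
    (m : nat) (x : 'I_m -> T) : \bar R :=
  ereal_sup [set
    \big[Order.min/+oo%E]_(y : {ffun 'I_m -> bool})
      ereal_sup [set
        \big[Order.min/+oo%E]_(i < m) ((-1) ^+ y i * (f (x i) - r i))%:E
        | f in F]
    | r in [set: 'I_m -> R]].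

Definition shattered (R : realType) (T : Type) (F : set (T -> R)) (gamma : R)
    (m : nat) (x : 'I_m -> T) : Prop :=
  (gamma%:E <= shatter_margin F x)%E.

(* A set of size m is presented by an injective enumeration of its points. *)
Definition fat (R : realType) (T : Type) (gamma : R) (F : set (T -> R)) :
    \bar R :=
  ereal_sup [set (m%:R)%:E | m in [set m : nat |
    exists x : 'I_m -> T, injective x /\ shattered F gamma x]].

(* Main.v *)
(** Write [K = k + 1].  If [m] points are shattered by the maxima of [K] affine
    functions with witness [r], then every subset of the points is a union of
    [K] sets of the form [{i | r i < f (x i)}] with [f] affine, so
    [2 ^ m <= N ^ K] where [N] counts the sets of this form.  By Pajor's lemma
    [N] is at most the number of index sets shattered by this family, and these
    have at most [d + 1] elements, since [d + 2] points of [R ^ d] satisfy an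
    affine dependence.  A subset of size at most [d + 1] contributes at least
    [1] to the sum of the [u ^ (#|S| - (d + 1))], so
    [N <= u ^ - (d + 1) * (1 + u) ^ m]; taking [u = 1 / (4 K)] gives
    [2 ^ m <= (4 K) ^ ((d + 1) K) * e ^ (m / 4)], which is solved for [m]
    by taking logarithms. *)
Require Import Defs.
From HB Require Import structures.
From mathcomp Require Import all_boot all_order all_algebra.
From mathcomp Require Import all_classical all_reals all_analysis.
From mathcomp Require Import ring lra.
Set Implicit Arguments.
Unset Strict Implicit.
Unset Printing Implicit Defensive.
Import Order.TTheory GRing.Theory Num.Theory.
Import numFieldNormedType.Exports.
Local Open Scope classical_set_scope.
Local Open Scope ring_scope.

(** * Shattering in finite set systems *)

Definition vc_shatters (T : finType) (A : {set {set T}}) (S : {set T}) : bool :=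
  [forall B : {set T}, (B \subset S) ==> [exists X in A, X :&: S == B]].

Lemma vc_shattersP (T : finType) (A : {set {set T}}) (S : {set T}) :
  reflect (forall B : {set T}, B \subset S -> exists2 X, X \in A & X :&: S = B)
          (vc_shatters A S).
Proof.
apply: (iffP forallP) => [h B BS | h B].
  by have /implyP/(_ BS)/exists_inP[X XA /eqP] := h B; exists X.
by apply/implyP => /h [X XA e]; apply/exists_inP; exists X => //; apply/eqP.
Qed.

Lemma vc_shatters_sub (T : finType) (A B : {set {set T}}) (S : {set T}) :
  A \subset B -> vc_shatters A S -> vc_shatters B S.
Proof.
move=> /fintype.subsetP AB /vc_shattersP h; apply/vc_shattersP => X /h [Y YA e].
by exists Y => //; apply: AB.
Qed.

(** By strong induction on [#|A|]: split [A] at a point [t] on which two members differ. A set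
    shattered by either half is shattered by [A] and avoids [t]; one shattered by both halves stays
    shattered by [A] after adding [t], which makes up for counting it twice. *)
Lemma pajor (T : finType) (A : {set {set T}}) :
  (#|A| <= #|[set S | vc_shatters A S]%SET|)%N.
Proof.
have [n] := ubnP #|A|; elim: n A => // n IH A; rewrite ltnS => An.
have [A1 | A1] := leqP #|A| 1.
  have [-> | [X XA]] := set_0Vmem A; first by rewrite cards0.
  apply: (leq_trans A1); apply/card_gt0P; exists finset.set0; rewrite inE.
  apply/vc_shattersP => B; rewrite finset.subset0 => /eqP ->.
  by exists X => //; rewrite finset.setI0.
have [X [Y [XA YA XY]]] : exists X Y, [/\ X \in A, Y \in A & X != Y].
  by move: A1 => /card_gt1P[X [Y [? ? ?]]]; exists X, Y.
have [t {XY} tXY] : exists t, (t \in X) != (t \in Y).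
  apply/existsP; apply: contraNT XY; rewrite negb_exists => /forallP h.
  by apply/eqP/setP => t; apply/eqP; have := h t; rewrite negbK.
pose A0 := [set Z in A | t \notin Z]%SET; pose At := [set Z in A | t \in Z]%SET.
have cA : #|A| = (#|A0| + #|At|)%N.
  rewrite addnC -(cardsID [set Z : {set T} | t \in Z]%SET A).
  congr (_ + _)%N; apply: eq_card => Z; rewrite !inE //.
  by rewrite andbC.
have lt0 : (0 < #|A0|)%N /\ (0 < #|At|)%N.
  split; apply/card_gt0P.
    case tX: (t \in X) tXY; last by exists X; rewrite inE XA tX.
    by move=> h; exists Y; rewrite inE YA; case: (t \in Y) h.
  case tX: (t \in X) tXY; first by exists X; rewrite inE XA tX.
  by move=> h; exists Y; rewrite inE YA; case: (t \in Y) h.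
have sub0 : A0 \subset A by apply/fintype.subsetP => Z; rewrite inE => /andP[].
have subt : At \subset A by apply/fintype.subsetP => Z; rewrite inE => /andP[].
have le0 : (#|A0| <= #|[set S | vc_shatters A0 S]%SET|)%N.
  by apply: IH; apply: leq_trans An; rewrite cA -addn1 leq_add2l; case: lt0.
have let1 : (#|At| <= #|[set S | vc_shatters At S]%SET|)%N.
  by apply: IH; apply: leq_trans An; rewrite cA -add1n leq_add2r; case: lt0.
rewrite cA; apply: (leq_trans (leq_add le0 let1)).
set S0 := [set S | vc_shatters A0 S]%SET; set St := [set S | vc_shatters At S]%SET.
(* No member of [A0] contains [t], so the trace [S] itself forces [t] out of [S]; for [At] the empty
   trace does. *)
have n0 S : S \in S0 -> t \notin S.
  rewrite inE => /vc_shattersP /(_ S (subxx _)) [Z + e]; rewrite inE -e inE.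
  by move=> /andP[_ /negPf ->].
have nt S : S \in St -> t \notin S.
  rewrite inE => /vc_shattersP /(_ finset.set0 (finset.sub0set _)) [Z + e]; rewrite inE.
  move=> /andP[_ tZ]; apply/negP => tS.
  by have := finset.in_set0 t; rewrite -e inE tZ tS.
rewrite -cardsUI.
have -> : #|S0 :&: St| = #|[set t |: S | S in S0 :&: St]%SET|.
  rewrite card_in_imset // => S S' /finset.setIP[/n0 tS _] /finset.setIP[/n0 tS' _] e.
  by rewrite -(finset.setU1K tS) -(finset.setU1K tS') e.
rewrite -cardsUI [X in (_ + X)%N](_ : _ = 0%N) ?addn0; last first.
  apply/eqP; rewrite cards_eq0; apply/eqP/setP => S; rewrite !inE.
  apply/negP => /andP[h /imsetP[S' _ e]].
  have tS : t \in S by rewrite e setU11.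
  by case/orP: h => h; [have := n0 S | have := nt S];
    rewrite inE h tS => /(_ isT).
apply: subset_leq_card; apply/fintype.subsetP => S; rewrite !inE -orbA.
case/or3P => [/(vc_shatters_sub sub0) // | /(vc_shatters_sub subt) // |].
case/imsetP => S' /finset.setIP[S'0 S't] ->.
have tS' := n0 _ S'0.
move: S'0 S't; rewrite !inE => /vc_shattersP h0 /vc_shattersP ht.
(* A trace containing [t] is realized by a member of [At], any other by a member of [A0]. *)
apply/vc_shattersP => B BS.
have BS' : B :\ t \subset S' by rewrite finset.subDset.
have [tB | tB] := boolP (t \in B).
- have [Z + e] := ht _ BS'; rewrite inE => /andP[ZA tZ].
  by exists Z => //; rewrite finset.setIUr e (finset.setIidPr _) ?finset.sub1set //
    finset.setD1K.
- have [Z + e] := h0 _ BS'; rewrite inE => /andP[ZA tZ].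
  exists Z => //; rewrite finset.setIUr e; apply/setP => y; rewrite !inE.
  by have [-> | _] := eqVneq y t; rewrite ?(negPf tZ) ?(negPf tB) ?andbF.
Qed.

Lemma card_small_sets (R : realFieldType) (T : finType) (n : nat) (u : R) :
  0 < u <= 1 ->
  #|[set S : {set T} | (#|S| <= n)%N]%SET|%:R <= u ^- n * (1 + u) ^+ #|T|.
Proof.
move=> /andP[u0 u1].
(* Expanding the product means choosing [u] on [S] and [1] off [S]. *)
have -> : (1 + u) ^+ #|T| = \sum_(S : {set T}) u ^+ #|S|.
  rewrite -prodr_const addrC bigA_distr; apply: eq_bigr => S _.
  by rewrite -big_mkcond prodr_const.
rewrite mulr_sumr -sum1_card natr_sum.
rewrite [X in _ <= X](bigID
  (fun S : {set T} => S \in [set S : {set T} | (#|S| <= n)%N]%SET)) /=.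
rewrite -[X in X <= _]addr0; apply: lerD; last first.
  by apply: sumr_ge0 => S _; rewrite mulr_ge0 ?invr_ge0 ?exprn_ge0 ?ltW.
apply: ler_sum => S; rewrite inE => Sn.
rewrite mulrC ler_pdivlMr ?exprn_gt0 // mul1r.
exact: ler_wiXn2l (ltW u0) u1 _ _ Sn.
Qed.

(** * Patterns cut out by affine functions and by their maxima *)

Definition upper_patterns (R : realType) (T : Type) (F : set (T -> R)) (m : nat)
    (x : 'I_m -> T) (r : 'I_m -> R) : {set {set 'I_m}} :=
  [set S : {set 'I_m} |
    `[< exists2 f, F f & S = [set i | r i < f (x i)]%SET >]]%SET.

(* For an affine dependence [v], the sum of the [v j * (f (x j) - r j)] does not
   depend on [f].  Up to the sign of [v] it is negative, or it is zero and some
   [v j] is positive; but the pattern [{j | 0 < v j}] makes every summand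
   nonnegative, and positive where [0 < v j]. *)
Lemma vc_affine (R : realType) (d m : nat) (x : 'I_m -> 'rV[R]_d)
    (r : 'I_m -> R) (S : {set 'I_m}) :
  vc_shatters (upper_patterns (@affine_class R d) x r) S -> (#|S| <= d.+1)%N.
Proof.
move=> /vc_shattersP shS; rewrite leqNgt; apply/negP => dS.
pose e (j : 'I_#|S|) := enum_val j.
(* The column of ones makes [v *m M = 0] an affine dependence: the coefficients also sum to zero. *)
pose M : 'M[R]_(#|S|, d + 1) := row_mx (\matrix_(j, l) x (e j) ord0 l) (const_mx 1).
have kn0 : kermx M != 0.
  rewrite -mxrank_eq0 mxrank_ker -lt0n subn_gt0.
  by apply: leq_ltn_trans (rank_leq_col M) _; rewrite addn1.
have [v vn0 vM] : exists2 v : 'rV[R]_#|S|, v != 0 & v *m M = 0.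
  have /rowV0Pn[v /sub_kermxP vM vn0] := kn0; by exists v.
have {}vM f : affine_class f -> \sum_j v ord0 j * f (x (e j)) = 0.
  case=> w [b ->].
  have vx l : \sum_j v ord0 j * x (e j) ord0 l = 0.
    have /matrixP/(_ ord0 (lshift 1 l)) := vM; rewrite !mxE => h.
    by rewrite -[RHS]h; apply: eq_bigr => j _; rewrite row_mxEl mxE.
  have v1 : \sum_j v ord0 j = 0.
    have /matrixP/(_ ord0 (rshift d ord0)) := vM; rewrite !mxE => h.
    by rewrite -[RHS]h; apply: eq_bigr => j _; rewrite row_mxEr mxE mulr1.
  under eq_bigr do rewrite mulrDr mulr_sumr.
  rewrite big_split /= -mulr_suml v1 mul0r addr0 exchange_big /=.
  apply: big1 => l _; under eq_bigr do rewrite mulrCA.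
  by rewrite -mulr_sumr vx mulr0.
(* The common value of the sums of [c j * (f (x (e j)) - r (e j))] over all affine [f], when [c] is
   a dependence. *)
pose s (c : 'I_#|S| -> R) := - \sum_j c j * r (e j).
have key (c : 'I_#|S| -> R) :
  (forall f, affine_class f -> \sum_j c j * f (x (e j)) = 0) ->
  s c <= 0 -> ~ (s c < 0 \/ exists j, 0 < c j).
  move=> cf sc pos.
  pose B := [set e j | j in [set j | 0 < c j]%SET]%SET.
  have BS : B \subset S.
    by apply/fintype.subsetP => _ /imsetP[j _ ->]; apply: enum_valP.
  have [X + XB] := shS _ BS; rewrite inE => /asboolP[f Ff XE].
  have sg j : (r (e j) < f (x (e j))) = (0 < c j).
    have -> : (0 < c j) = (e j \in B).
      by rewrite mem_imset ?inE //; apply: enum_val_inj.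
    by rewrite -XB XE !inE enum_valP andbT.
  have sE : s c = \sum_j c j * (f (x (e j)) - r (e j)).
    by under [RHS]eq_bigr do rewrite mulrBr; rewrite sumrB cf // sub0r.
  have ge0 j : 0 <= c j * (f (x (e j)) - r (e j)).
    have [cj | cj] := ltP 0 (c j).
      by rewrite mulr_ge0 ?ltW // subr_gt0 sg.
    by rewrite mulr_le0 // subr_le0 leNgt sg -leNgt.
  move: sc; rewrite leNgt => /negP; apply; case: pos => [|[j0 cj0]].
    by rewrite [s c < 0]ltNge sE sumr_ge0.
  rewrite sE (bigD1 j0) //= ltr_pwDl ?sumr_ge0 //.
  by rewrite mulr_gt0 // subr_gt0 sg.
have [j vj] : exists j, v ord0 j != 0 by apply/rV0Pn.
have Nv f : affine_class f -> \sum_j (- v ord0 j) * f (x (e j)) = 0.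
  move=> /vM h; under eq_bigr do rewrite mulNr.
  by rewrite sumrN h oppr0.
have sN : s (fun j => - v ord0 j) = - s (v ord0).
  by rewrite /s; under eq_bigr do rewrite mulNr; rewrite sumrN.
have kN := key (fun j => - v ord0 j) Nv; rewrite sN oppr_le0 oppr_lt0 in kN.
have kv := key (v ord0) vM.
case: (ltgtP (s (v ord0)) 0) kN kv => [s_lt0 _ | s_gt0 + _ | _ kN kv].
- by apply=> //; left.
- by apply=> //; left.
- move: vj; rewrite neq_lt => /orP[vj | vj].
    by apply: kN => //; right; exists j; rewrite oppr_gt0.
  by apply: kv => //; right; exists j.
Qed.

(** A maximum exceeds [r l] exactly when one of its arguments does, so each pattern on the left is a
    union indexed by a function from ['I_k.+1] to [P]. *)
Lemma upper_patterns_Gmax (R : realType) (T : Type) (F : set (T -> R))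
    (k m : nat) (x : 'I_m -> T) (r : 'I_m -> R) :
  (#|upper_patterns (Gmax (fun _ : 'I_k.+1 => F)) x r|
     <= #|upper_patterns F x r| ^ k.+1)%N.
Proof.
set P := upper_patterns F x r.
rewrite -[in X in (_ ^ X)%N](card_ord k.+1) -card_ffun_on.
pose U (h : {ffun 'I_k.+1 -> {set 'I_m}}) := (\bigcup_i h i)%SET.
apply: leq_trans (leq_imset_card U _).
apply: subset_leq_card; apply/fintype.subsetP => S; rewrite inE => /asboolP.
case=> _ [f [Ff ->]] ->; apply/imsetP.
exists [ffun i => [set l | r l < f i (x l)]%SET].
  apply/ffun_onP => i; rewrite ffunE inE; apply/asboolP; by exists (f i).
apply/setP => l; rewrite inE; apply/bigmax_gtP/bigcupP.
  (* The initial value of the iterated maximum is charged to index [ord0]. *)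
  case=> [h | [i _ h]]; first by exists ord0; rewrite // ffunE inE.
  by exists i; rewrite // ffunE inE.
by case=> i _; rewrite ffunE inE => h; right; exists i.
Qed.

(** The suprema need not be attained, but each is strictly positive, which yields an actual [r] and
    then an actual [f] for each sign vector. *)
Lemma shattered_upper_patterns (R : realType) (T : Type) (F : set (T -> R))
    (gamma : R) (m : nat) (x : 'I_m -> T) :
  0 < gamma -> shattered F gamma x ->
  exists r, upper_patterns F x r = [set: {set 'I_m}]%SET.
Proof.
move=> g0 sh.
have /ereal_sup_gt[_ [r _ <-]] : (0 < shatter_margin F x)%E.
  by apply: lt_le_trans sh; rewrite lte_fin.
move=> /bigmin_gtP[_ h]; exists r; apply/setP => S; rewrite !inE.
(* The boolean [true] encodes the sign -1, hence the complement of [S]. *)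
have /ereal_sup_gt[_ [f Ff <-]] := h [ffun i => i \notin S] isT.
move=> /bigmin_gtP[_ hf]; apply/asboolP; exists f => //.
apply/setP => i; rewrite inE; have := hf i isT; rewrite ffunE lte_fin.
have [iS | iS] /= := boolP (i \in S).
  by rewrite expr0 mul1r subr_gt0 => ->.
by rewrite expr1 mulN1r opprB subr_gt0 => /ltW; rewrite leNgt => /negPf ->.
Qed.

(** A bound of Sauer-Shelah type, with a free parameter [u] in place of a sum of binomial
    coefficients. *)
Lemma card_upper_patterns_affine (R : realType) (d m : nat)
    (x : 'I_m -> 'rV[R]_d) (r : 'I_m -> R) (u : R) : 0 < u <= 1 ->
  (#|upper_patterns (@affine_class R d) x r|)%:R <= u ^- d.+1 * (1 + u) ^+ m.
Proof.
move=> u01; rewrite -[in X in _ * X](card_ord m).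
apply: le_trans (card_small_sets _ d.+1 u01).
rewrite ler_nat; apply: leq_trans (pajor _) _; apply: subset_leq_card.
by apply/fintype.subsetP => S; rewrite !inE; apply: vc_affine.
Qed.

(** * Numerical estimates and the final bound *)

(** With [M] the maximum of [e] and [k.+1], the bound [2 <= e <= M] gives [4 <= M ^+ 2], so
    [4 * k.+1 <= M ^+ 3]. *)
Lemma ln4M_le_Log (R : realType) (k : nat) :
  ln (4 * k.+1%:R) <= 3 * Log k.+1%:R :> R.
Proof.
set M : R := Num.max (expR 1) k.+1%:R.
have M0 : 0 < M by rewrite lt_max expR_gt0.
have e2 : 2 <= expR 1 :> R := expR_ge1Dx 1.
rewrite /Log -/M [leRHS]mulr_natl -lnXn // ler_ln ?posrE ?exprn_gt0 ?mulr_gt0 //.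
have kM : k.+1%:R <= M by rewrite le_max lexx orbT.
have eM : expR 1 <= M by rewrite le_max lexx.
have k0 : 0 < k.+1%:R :> R by rewrite ltr0n.
rewrite exprS mulrC expr2; apply: ler_pM => //; nra.
Qed.

Lemma shattered_Gmax_affine_size (R : realType) (d k m : nat) (gamma : R)
    (x : 'I_m -> 'rV[R]_d) : 0 < gamma ->
  shattered (Gmax (fun _ : 'I_k.+1 => @affine_class R d)) gamma x ->
  m%:R <= 4 * (d.+1%:R * k.+1%:R * ln (4 * k.+1%:R)) :> R.
Proof.
move=> g0 /(shattered_upper_patterns g0)[r hr].
have := upper_patterns_Gmax (@affine_class R d) k x r.
rewrite hr -powersetT card_powerset cardsT card_ord => le2m.
set K : R := k.+1%:R; have K1 : 1 <= K by rewrite ler1n.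
have K0 : 0 < K by rewrite ltr0n.
have K40 : 0 < 4 * K by rewrite mulr_gt0.
pose u := (4 * K)^-1.
have u0 : 0 < u by rewrite invr_gt0.
have u1 : u <= 1 by rewrite invf_le1 //; lra.
have u01 : 0 < u <= 1 by rewrite u0 u1.
have cnt := card_upper_patterns_affine x r u01.
have le2 : 2 ^+ m <= (u ^- d.+1 * (1 + u) ^+ m) ^+ k.+1.
  rewrite -natrX; apply: (@le_trans _ _
    (#|upper_patterns (@affine_class R d) x r|%:R ^+ k.+1)).
    by rewrite -natrX ler_nat.
  by apply: lerXn2r cnt; rewrite nnegrE ?mulr_ge0 ?invr_ge0 ?exprn_ge0 ?addr_ge0 // ltW.
have ulnu : ln (1 + u) <= u.
  by rewrite -[leRHS]expRK ler_ln ?posrE ?expR_gt0 ?expR_ge1Dx ?addr_gt0.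
have uV : u^-1 = 4 * K by rewrite invrK.
(* From [1 - 1/2 <= expR (- 1/2)]. *)
have ln2 : 2^-1 <= ln 2 :> R.
  rewrite -[leLHS]expRK ler_ln ?posrE ?expR_gt0 //.
  have := expR_ge1Dx (- 2^-1 : R); rewrite expRN => h.
  by rewrite -[leRHS]invrK -lef_pV2 ?posrE ?invr_gt0 ?expR_gt0 // invrK; lra.
have {le2} : ln (2 ^+ m) <= ln ((u ^- d.+1 * (1 + u) ^+ m) ^+ k.+1).
  by rewrite ler_ln ?posrE ?exprn_gt0 ?mulr_gt0 ?invr_gt0 ?exprn_gt0 ?addr_gt0.
rewrite !lnXn ?mulr_gt0 ?invr_gt0 ?exprn_gt0 ?addr_gt0 //.
rewrite [in X in _ <= X -> _]lnM ?posrE ?invr_gt0 ?exprn_gt0 ?addr_gt0 //.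
rewrite -exprVn uV !lnXn ?addr_gt0 // -[ln 2 *+ m]mulr_natr -[ln (4 * K) *+ _]mulr_natr.
rewrite -[ln (1 + u) *+ m]mulr_natr -[(_ + _) *+ k.+1]mulr_natr -/K mulrDl => le2.
(* The choice of [u] keeps this term below half of the lower bound [m / 2] for [m * ln 2]; the
   remaining [m / 4] produces the factor 4. *)
have uK : ln (1 + u) * m%:R * K <= m%:R / 4.
  apply: (@le_trans _ _ (u * m%:R * K)).
    by apply: ler_wpM2r; [exact: ltW | apply: ler_wpM2r].
  by rewrite mulrAC /u invfM -(mulrA _ _ K) mulVf ?gt_eqF // mulr1 mulrC.
have m2 : 2^-1 * m%:R <= ln 2 * m%:R :> R by apply: ler_wpM2r.
rewrite [X in 4 * X](_ : _ = ln (4 * K) * d.+1%:R * K); last first.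
  by rewrite mulrC mulrA.
lra.
Qed.

Theorem theorem7 (R : realType) :
  exists C : R, 0 < C /\
    forall (d k : nat) (gamma : R), (0 < d)%N -> 0 < gamma ->
      (fat gamma (Gmax (fun _ : 'I_k.+1 => @affine_class R d))
         <= (C * d%:R * k.+1%:R * Log k.+1%:R)%:E)%E.
Proof.
(* 24 = 4 * 2 * 3: the factor 4 of the size bound, 2 from [d.+1 <= 2 * d] for positive [d], and 3
   from [ln4M_le_Log]. *)
exists 24; split=> // d k gamma d0 g0.
apply: ge_ereal_sup => _ [m [x [_ sh]] <-]; rewrite lee_fin.
apply: le_trans (shattered_Gmax_affine_size g0 sh) _.
have d2 : d.+1%:R <= 2 * d%:R :> R.
  by rewrite -natrM ler_nat mul2n -addnn -addn1 leq_add2l.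
have L3 := ln4M_le_Log R k.
have L0 : 0 <= ln (4 * k.+1%:R : R).
  by rewrite ln_ge0 // -natrM ler1n.
apply: (@le_trans _ _ (4 * (2 * d%:R * k.+1%:R * (3 * Log k.+1%:R)))); last first.
  by rewrite le_eqVlt; apply/orP; left; apply/eqP; ring.
rewrite ler_pM2l //; apply: ler_pM => //.
by rewrite ler_wpM2r.
Qed.
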